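(* Let $a<b$. Let $f,g:[a,b]\to\mathbb{R}$ be absolutely $\beta$-integrable functions on $[a,b]$, and suppose that there exist real numbers $m$ and $M$ such that $m\le f(x)\le M$ for all $x\in[a,b]_\beta$. If $a\le s_0\le b$, then $$\left|T_\beta(f,g)\right|\le\frac12(M-m)\,\frac{1}{b-a}\int_a^b\left|g(x)-\frac{1}{b-a}\int_a^b g(t)\,d_\beta t\right|d_\beta x\le\frac12(M-m)\sqrt{T_\beta(g,g)} .$$
   Context: Setting: $I\subseteq\mathbb{R}$ is an interval, $a,b\in I$, and $\beta:I\to I$ is a strictly increasing continuous function with exactly one fixed point $s_0\in I$, satisfying $(t-s_0)(\beta(t)-t)\le 0$ for all $t\in I$, with equality only if $t=s_0$. Write $\beta^0(t)=t$ and $\beta^k$ for the $k$-fold composition of $\beta$ with itself. The $\beta$-interval is $[a,b]_\beta:=\{\beta^k(a):k\ge 0\}\cup\{\beta^k(b):k\ge 0\}\cup\{s_0\}$. The $\beta$-integral is $\int_a^b h\,d_\beta:=\int_{s_0}^b h\,d_\beta-\int_{s_0}^a h\,d_\beta$, where $\int_{s_0}^x h\,d_\beta:=\sum_{k=0}^{\infty}\big(\beta^k(x)-\beta^{k+1}(x)\big)h\big(\beta^k(x)\big)$; also written $\int_a^b h(x)\,d_\beta x$. The function $h$ is $\beta$-integrable on $[a,b]$ if these series converge for $x=a$ and $x=b$, and absolutely $\beta$-integrable on $[a,b]$ if $|h|$ is $\beta$-integrable on $[a,b]$. For two absolutely $\beta$-integrable functions $f,g:[a,b]\to\mathbb{R}$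 on $[a,b]$, the Chebyshev functional is $$T_\beta(f,g):=\frac{1}{b-a}\int_a^b f(x)g(x)\,d_\beta x-\left(\frac{1}{b-a}\int_a^b f(x)\,d_\beta x\right)\left(\frac{1}{b-a}\int_a^b g(x)\,d_\beta x\right).$$ *)

(* Defs.v *)
From mathcomp Require Import all_boot all_order all_algebra.
From mathcomp Require Import all_classical all_reals all_analysis.
Set Implicit Arguments.
Unset Strict Implicit.
Unset Printing Implicit Defensive.
Import Order.TTheory GRing.Theory Num.Theory numFieldNormedType.Exports.
Local Open Scope classical_set_scope.
Local Open Scope ring_scope.

Section beta_calculus.
Context {R : realType}.
Implicit Types (I : interval R) (beta : R -> R) (s a b x : R).

(* Only the values of [beta] on [I] matter; the function is total because
   [iter] needs a type as domain. *)
Definition is_beta_map I beta s0 : Prop :=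
  [/\ {homo beta : t / t \in I},
      {in I &, {homo beta : t u / t < u}},
      {within [set` I], continuous beta},
      [/\ s0 \in I, beta s0 = s0 & {in I, forall t, beta t = t -> t = s0}] &
      {in I, forall t, (t - s0) * (beta t - t) <= 0 /\
                       ((t - s0) * (beta t - t) = 0 -> t = s0)}].

Definition beta_interval beta s0 a b : set R :=
  range (fun k => iter k beta a) `|` range (fun k => iter k beta b)
  `|` [set s0].

Definition beta_weight beta x (k : nat) : R :=
  iter k beta x - iter k.+1 beta x.

Definition beta_series beta (h : R -> R) x : R^nat :=
  series (fun k => beta_weight beta x k * h (iter k beta x)).

Definition beta_integrable beta (h : R -> R) a b : Prop :=
  cvgn (beta_series beta h a) /\ cvgn (beta_series beta h b).

Definition abs_beta_integrable beta (h : R -> R) a b : Prop :=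
  beta_integrable beta (fun x => `|h x|) a b.

Local Open Scope ereal_scope.

(* The integral is extended-real valued, like [\int[mu]_(x in D) h x]: for an
   absolutely beta-integrable [g], the square of [g] need not be
   beta-integrable. If [a <= s0 <= b] and [0 <= h] the difference in [beta_int]
   is a sum of two elements of [0, +oo], hence never of the form oo - oo. For
   real-valued beta-integrable [h] see [beta_int_EFin] below. *)
Definition beta_int0 beta (h : R -> \bar R) x : \bar R :=
  \sum_(0 <= k <oo) (beta_weight beta x k)%:E * h (iter k beta x).

Definition beta_int beta a b (h : R -> \bar R) : \bar R :=
  beta_int0 beta h b - beta_int0 beta h a.

Definition chebyshev_functional beta a b (f g : R -> R) : \bar R :=
  ((b - a)^-1)%:E * beta_int beta a b (fun x => (f x * g x)%:E)
  - (((b - a)^-1)%:E * beta_int beta a b (fun x => (f x)%:E))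
    * (((b - a)^-1)%:E * beta_int beta a b (fun x => (g x)%:E)).

Lemma beta_int_EFin beta a b (h : R -> R) : beta_integrable beta h a b ->
  beta_int beta a b (fun x => (h x)%:E) =
  (limn (beta_series beta h b) - limn (beta_series beta h a))%:E.
Proof.
have int0E x : cvgn (beta_series beta h x) ->
    beta_int0 beta (fun x => (h x)%:E) x = (limn (beta_series beta h x))%:E.
  move=> cvx; rewrite -EFin_lim//; congr (limn _); apply/funext => n.
  by rewrite /= /beta_series /series /= -sumEFin.
by move=> [cva cvb]; rewrite /beta_int !int0E.
Qed.

End beta_calculus.

(* Main.v *)
(* Since a <= s0 <= b, the weights of the beta-integral over [a, b] are
   nonnegative, and they sum to b - a because both orbits converge to s0; hence
   E h := (b - a)^-1 * int_a^b h is a monotone linear functional with E 1 = 1.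
   Then T(f, g) = E ((f - c) (g - E g)) for every constant c; taking c = (m + M) / 2
   gives |f - c| <= (M - m) / 2 and the first bound. The second one is
   (E |g - E g|)^2 <= E (g - E g)^2 = T(g, g) when the square of g is integrable,
   and T(g, g) = +oo otherwise. *)
Require Import Defs.
From mathcomp Require Import all_boot all_order all_algebra.
From mathcomp Require Import all_classical all_reals all_analysis.
From mathcomp Require Import ring lra.
Import Order.TTheory GRing.Theory Num.Theory numFieldNormedType.Exports.
Local Open Scope classical_set_scope.
Local Open Scope ring_scope.

(** * Orbits of [beta] and their convergence to the fixed point *)

Section orbits.
Context {R : realType} {I : interval R} {beta : R -> R} {s0 : R}.
Hypothesis hbeta : is_beta_map I beta s0.

Lemma iter_beta_in x k : x \in I -> iter k beta x \in I.
Proof. by case: hbeta => bI _ _ _ _ xI; elim: k => //= k; exact: bI. Qed.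

(** Monotonicity against the fixed point gives the lower bound, the sign condition the upper one. *)
Lemma beta_ge_fix t : t \in I -> s0 <= t -> s0 <= beta t <= t.
Proof.
case: hbeta => _ bmono _ [s0I bs0 _] bsign tI; rewrite le_eqVlt => /predU1P[<-|st].
  by rewrite bs0 lexx.
rewrite -{1}bs0 (ltW (bmono _ _ s0I tI st))/=.
have [+ _] := bsign _ tI; by rewrite pmulr_rle0 ?subr_gt0// subr_le0.
Qed.

Lemma beta_le_fix t : t \in I -> t <= s0 -> t <= beta t <= s0.
Proof.
case: hbeta => _ bmono _ [s0I bs0 _] bsign tI; rewrite le_eqVlt => /predU1P[->|ts].
  by rewrite bs0 lexx.
rewrite -{1}bs0 (ltW (bmono _ _ tI s0I ts))/= andbT.
have [+ _] := bsign _ tI; by rewrite nmulr_rle0 ?subr_lt0// subr_ge0.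
Qed.

Lemma iter_beta_ge x k : x \in I -> s0 <= x -> s0 <= iter k beta x.
Proof.
move=> xI sx; elim: k => //= k ih.
by have /andP[] := beta_ge_fix _ (iter_beta_in _ k xI) ih.
Qed.

Lemma iter_beta_le x k : x \in I -> x <= s0 -> iter k beta x <= s0.
Proof.
move=> xI xs; elim: k => //= k ih.
by have /andP[] := beta_le_fix _ (iter_beta_in _ k xI) ih.
Qed.

Lemma beta_weight_ge0 x k : x \in I -> s0 <= x -> 0 <= beta_weight beta x k.
Proof.
move=> xI sx; rewrite subr_ge0 /=.
by have /andP[] := beta_ge_fix _ (iter_beta_in _ k xI) (iter_beta_ge _ k xI sx).
Qed.

Lemma beta_weight_le0 x k : x \in I -> x <= s0 -> beta_weight beta x k <= 0.
Proof.
move=> xI xs; rewrite subr_le0 /=.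
by have /andP[] := beta_le_fix _ (iter_beta_in _ k xI) (iter_beta_le _ k xI xs).
Qed.

(** By continuity the shifted orbit tends to [beta l] as well as to [l], so [l] is a fixed point,
    and there is only one. *)
Lemma iter_beta_cvg_fix x l : x \in I -> l \in I ->
  iter k beta x @[k --> \oo] --> l -> l = s0.
Proof.
move=> xI lI xl; case: hbeta => _ _ /subspace_continuousP bcont [_ _ bfix] _.
apply: (bfix _ lI); have bl := bcont l lI.
have : iter k.+1 beta x @[k --> \oo] --> beta l.
  (* [bl] only speaks of neighbourhoods of [l] within [I], so the orbit has to be kept inside
     [I]. *)
  apply: (cvg_comp (fun k => iter k beta x) beta _ bl).
  move=> A /= wA; near=> k.
  have : [set` I] (iter k beta x) by exact: iter_beta_in.
  near: k; exact: (xl _ wA).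
rewrite (cvg_shiftS (fun k => iter k beta x)) => xbl.
exact: (cvg_unique _ xbl xl).
Unshelve. all: by end_near. Qed.

(** The orbit is monotone and bounded by [s0], hence converges. Its limit lies between [x] and [s0],
    so in [I] by convexity, whether or not [I] is closed. *)
Lemma iter_beta_cvg x : x \in I -> iter k beta x @[k --> \oo] --> s0.
Proof.
move=> xI; have s0I : s0 \in I by case: hbeta => _ _ _ [].
have conv c d t : c \in I -> d \in I -> c <= t <= d -> t \in I.
  by move=> cI dI ctd; apply: (@interval_is_interval _ I c d).
set u := fun k => iter k beta x; rewrite -/u.
have [sx|/ltW xs] := leP s0 x.
  have udec : {homo u : n m / (n <= m)%N >-> m <= n}.
    apply/nonincreasing_seqP => k; rewrite -subr_ge0.
    exact: beta_weight_ge0.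
  have cu : cvgn u.
    apply: nonincreasing_is_cvgn => //.
    by exists s0 => _ [k _ <-]; exact: iter_beta_ge.
  suff lI : limn u \in I by rewrite -(iter_beta_cvg_fix x _ xI lI cu).
  apply: (conv s0 x) => //.
  rewrite (nonincreasing_cvgn_ge udec cu 0%N) andbT.
  by apply: limr_ge => //; near=> k; exact: iter_beta_ge.
have uinc : {homo u : n m / (n <= m)%N >-> n <= m}.
  apply/nondecreasing_seqP => k; rewrite -subr_le0.
  exact: beta_weight_le0.
have cu : cvgn u.
  apply: nondecreasing_is_cvgn => //.
  by exists s0 => _ [k _ <-]; exact: iter_beta_le.
suff lI : limn u \in I by rewrite -(iter_beta_cvg_fix x _ xI lI cu).
apply: (conv x s0) => //.
rewrite (nondecreasing_cvgn_le uinc cu 0%N)/=.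
by apply: limr_le => //; near=> k; exact: iter_beta_le.
Unshelve. all: by end_near. Qed.

(** The partial sums telescope to [(x - iter n beta x) * c]. *)
Lemma beta_series_cst x c : x \in I ->
  beta_series beta (fun=> c) x n @[n --> \oo] --> (x - s0) * c.
Proof.
move=> xI.
have -> : beta_series beta (fun=> c) x = (fun n => (x - iter n beta x) * c).
  apply/funext => n; rewrite /beta_series /series/= -mulr_suml; congr (_ * _).
  rewrite -[RHS]opprB -(telescope_sumr (fun k => iter k beta x) (leq0n n)).
  by rewrite -sumrN; apply: eq_bigr => k _; rewrite opprB.
by apply: cvgM (cvg_cst _); apply: cvgB (cvg_cst _) _; exact: iter_beta_cvg.
Qed.

End orbits.

(** * The normalised integral as a real-valued linear functional *)

Section beta_mean.
Context {R : realType} (beta : R -> R) (a b : R).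
Implicit Types h : R -> R.

(** The functional E of the overview, kept in [R] so that ring reasoning applies. It is meaningful
    only for integrable [h], since [limn] of a divergent sequence is a default value. *)
Definition beta_mean h : R :=
  (b - a)^-1 * (limn (beta_series beta h b) - limn (beta_series beta h a)).

Lemma beta_seriesD h1 h2 x :
  beta_series beta (fun x => h1 x + h2 x) x =
  beta_series beta h1 x + beta_series beta h2 x.
Proof.
rewrite /beta_series -seriesD; congr series; apply/funext => k /=.
by rewrite mulrDr.
Qed.

Lemma beta_seriesZ c h x :
  beta_series beta (fun x => c * h x) x =
  series (c *: (fun k => beta_weight beta x k * h (iter k beta x))).
Proof. by congr series; apply/funext => k /=; rewrite mulrCA. Qed.

Lemma beta_integrableD h1 h2 : beta_integrable beta h1 a b ->
  beta_integrable beta h2 a b -> beta_integrable beta (fun x => h1 x + h2 x) a b.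
Proof.
by move=> [a1 b1] [a2 b2]; split; rewrite beta_seriesD; exact: is_cvgD.
Qed.

Lemma beta_integrableZ c h : beta_integrable beta h a b ->
  beta_integrable beta (fun x => c * h x) a b.
Proof.
by move=> [ca cb]; split; rewrite beta_seriesZ; exact: is_cvg_seriesZ.
Qed.

Lemma beta_meanD h1 h2 : beta_integrable beta h1 a b ->
  beta_integrable beta h2 a b ->
  beta_mean (fun x => h1 x + h2 x) = beta_mean h1 + beta_mean h2.
Proof.
move=> [a1 b1] [a2 b2]; rewrite /beta_mean !beta_seriesD !limD//.
by rewrite opprD addrACA mulrDr.
Qed.

Lemma beta_meanZ c h : beta_integrable beta h a b ->
  beta_mean (fun x => c * h x) = c * beta_mean h.
Proof.
by move=> [ca cb]; rewrite /beta_mean !beta_seriesZ !lim_seriesZ// -scalerBr mulrCA.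
Qed.

Lemma beta_int_mean h : beta_integrable beta h a b ->
  (((b - a)^-1)%:E * beta_int beta a b (fun x => (h x)%:E))%E = (beta_mean h)%:E.
Proof. by move=> ih; rewrite beta_int_EFin. Qed.

End beta_mean.

(** * Extended-real limits of nondecreasing real sequences *)

Lemma limn_EFin_nondecreasing_dvg {R : realType} (u : R^nat) :
  nondecreasing_seq u -> ~ cvgn u -> limn (EFin \o u) = +oo%E.
Proof.
move=> ndu dvu; apply/cvg_lim => //; apply/cvgeryP.
exact: nondecreasing_dvgn_lt.
Qed.

Lemma limn_EFin_nondecreasing_ge0 {R : realType} (u : R^nat) :
  nondecreasing_seq u -> u 0%N = 0 -> (0 <= limn (EFin \o u))%E.
Proof.
move=> ndu u0; have cu : cvgn (EFin \o u).
  by apply: ereal_nondecreasing_is_cvgn => m n mn; rewrite lee_fin ndu.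
by apply: lime_ge => //; near=> n; rewrite lee_fin -u0 ndu.
Unshelve. all: by end_near. Qed.

(** * Order properties of the mean when [a <= s0 <= b] *)

Section positivity.
Context {R : realType} {I : interval R} {beta : R -> R} {s0 a b : R}.
Hypotheses (hbeta : is_beta_map I beta s0) (aI : a \in I) (bI : b \in I).
Hypotheses (ltab : a < b) (as0b : a <= s0 <= b).
Implicit Types h : R -> R.

Let wa_le0 k : beta_weight beta a k <= 0.
Proof. by case/andP: as0b => ? _; exact: (beta_weight_le0 hbeta). Qed.

Let wb_ge0 k : 0 <= beta_weight beta b k.
Proof. by case/andP: as0b => _ ?; exact: (beta_weight_ge0 hbeta). Qed.

Let orbita k : beta_interval beta s0 a b (iter k beta a).
Proof. by left; left; exists k. Qed.

Let orbitb k : beta_interval beta s0 a b (iter k beta b).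
Proof. by left; right; exists k. Qed.

Lemma beta_integrable_cst c : beta_integrable beta (fun=> c) a b.
Proof.
by split; apply/cvg_ex; eexists; exact: (beta_series_cst hbeta _ c).
Qed.

Lemma beta_mean_cst c : beta_mean beta a b (fun=> c) = c.
Proof.
rewrite /beta_mean (cvg_lim _ (beta_series_cst hbeta _ c aI))//.
rewrite (cvg_lim _ (beta_series_cst hbeta _ c bI))//.
by field; rewrite subr_eq0 gt_eqF.
Qed.

(** The weights at [a] are nonpositive, but that series is subtracted, so both endpoints contribute
    monotonically. *)
Lemma le_beta_mean h1 h2 :
  beta_integrable beta h1 a b -> beta_integrable beta h2 a b ->
  (forall x, beta_interval beta s0 a b x -> h1 x <= h2 x) ->
  beta_mean beta a b h1 <= beta_mean beta a b h2.
Proof.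
move=> [a1 b1] [a2 b2] h12; rewrite ler_pM2l ?invr_gt0 ?subr_gt0//.
apply: lerB; apply: lim_series_le => // k.
  by rewrite ler_wpM2l ?h12.
by rewrite ler_wnM2l ?h12.
Qed.

Lemma le_beta_integrable h k : beta_integrable beta k a b ->
  (forall x, beta_interval beta s0 a b x -> `|h x| <= k x) ->
  beta_integrable beta h a b.
Proof.
move=> [ka kb] hk; split; apply: normed_cvg.
  (* The sign change at [a] makes the majorant nonnegative, as the comparison test requires. *)
  have nka : cvgn (series (fun n => - (beta_weight beta a n * k (iter n beta a)))).
    by rewrite seriesN; exact: is_cvgN.
  apply: series_le_cvg nka => n /=; rewrite -?mulNr//.
    by rewrite mulr_ge0 ?oppr_ge0// (le_trans _ (hk _ _)).
  by rewrite normrM ler0_norm// ler_wpM2l ?oppr_ge0// hk.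
apply: series_le_cvg kb => n //=.
  by rewrite mulr_ge0// (le_trans _ (hk _ _)).
by rewrite normrM ger0_norm// ler_wpM2l// hk.
Qed.

(** The integral is a sum of two limits in [0, +oo], at least one of which is +oo. This serves the
    case where the square of [g] is not integrable. *)
Lemma beta_int_dvg h : (forall x, 0 <= h x) -> ~ beta_integrable beta h a b ->
  beta_int beta a b (fun x => (h x)%:E) = +oo%E.
Proof.
move=> h0 nint.
have int0E x : beta_int0 beta (fun x => (h x)%:E) x =
    limn (EFin \o beta_series beta h x).
  by congr (limn _); apply/funext => n; rewrite /= /beta_series /series /= -sumEFin.
have ndb : nondecreasing_seq (beta_series beta h b).
  apply/nondecreasing_seqP => n; rewrite /beta_series/= seriesSr lerDl.
  by rewrite mulr_ge0.
have nda : nondecreasing_seq (- beta_series beta h a).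
  apply/nondecreasing_seqP => n; rewrite /beta_series/= !fctE seriesSr lerN2 gerDl.
  by rewrite mulr_le0_ge0.
have b0 : beta_series beta h b 0%N = 0 by rewrite /beta_series /series/= big_geq.
have a0 : (- beta_series beta h a) 0%N = 0.
  by rewrite fctE /beta_series /series/= big_geq// oppr0.
have leb := limn_EFin_nondecreasing_ge0 _ ndb b0.
have lea := limn_EFin_nondecreasing_ge0 _ nda a0.
have -> : beta_int beta a b (fun x => (h x)%:E) =
    (limn (EFin \o beta_series beta h b) +
     limn (EFin \o (- beta_series beta h a)%R))%E.
  rewrite /beta_int !int0E -limeN// -is_cvgeNE.
  by apply: ereal_nondecreasing_is_cvgn => m n mn; rewrite lee_fin nda.
have [cb|dvb] := pselect (cvgn (beta_series beta h b)); last first.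
  by rewrite (limn_EFin_nondecreasing_dvg _ ndb dvb) addye//
    -ltNye (lt_le_trans _ lea).
have dva : ~ cvgn (- beta_series beta h a).
  by rewrite is_cvgNE => ca; apply: nint.
by rewrite (limn_EFin_nondecreasing_dvg _ nda dva) addey//
  -ltNye (lt_le_trans _ leb).
Qed.

Lemma normr_beta_mean h k :
  beta_integrable beta h a b -> beta_integrable beta k a b ->
  (forall x, beta_interval beta s0 a b x -> `|h x| <= k x) ->
  `|beta_mean beta a b h| <= beta_mean beta a b k.
Proof.
move=> ih ik hk; rewrite ler_norml -mulN1r -beta_meanZ//.
apply/andP; split; apply: le_beta_mean => //.
- exact: beta_integrableZ.
- by move=> x /hk; rewrite ler_norml mulN1r => /andP[].
- by move=> x /hk; rewrite ler_norml => /andP[].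
Qed.

Lemma beta_integrable_norm h :
  abs_beta_integrable beta h a b -> beta_integrable beta h a b.
Proof. by move=> ih; apply: (le_beta_integrable _ _ ih). Qed.

Lemma beta_integrable_dev g c : abs_beta_integrable beta g a b ->
  beta_integrable beta (fun x => `|g x - c|) a b.
Proof.
move=> ig; apply: (le_beta_integrable _ (fun x => `|g x| + `|c|)).
  by apply: beta_integrableD ig _; exact: beta_integrable_cst.
by move=> x _; rewrite normr_id ler_normB.
Qed.

(** Expanding the product, the terms in [c] cancel because [g] minus its mean has mean zero. *)
Lemma beta_mean_covariance f g c :
  beta_integrable beta f a b -> beta_integrable beta g a b ->
  beta_integrable beta (fun x => f x * g x) a b ->
  let: h := fun x => (f x - c) * (g x - beta_mean beta a b g) in
  beta_integrable beta h a b /\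
  beta_mean beta a b h = beta_mean beta a b (fun x => f x * g x)
    - beta_mean beta a b f * beta_mean beta a b g.
Proof.
move=> intf intg intfg; set d := beta_mean beta a b g.
have -> : (fun x => (f x - c) * (g x - d)) =
    (fun x => f x * g x + (- d * f x + (- c * g x + c * d))).
  by apply/funext => x; ring.
have intcd := beta_integrable_cst (c * d).
have intcg := beta_integrableZ _ _ _ (- c) _ intg.
have intdf := beta_integrableZ _ _ _ (- d) _ intf.
have int1 := beta_integrableD _ _ _ _ _ intcg intcd.
have int2 := beta_integrableD _ _ _ _ _ intdf int1.
split; first exact: beta_integrableD.
rewrite !beta_meanD// beta_mean_cst !beta_meanZ// -/d; ring.
Qed.

Lemma beta_mean_gruss f g m M :
  beta_integrable beta f a b -> abs_beta_integrable beta g a b ->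
  beta_integrable beta (fun x => f x * g x) a b ->
  (forall x, beta_interval beta s0 a b x -> m <= f x <= M) ->
  `|beta_mean beta a b (fun x => f x * g x)
    - beta_mean beta a b f * beta_mean beta a b g|
  <= 2^-1 * (M - m) *
     beta_mean beta a b (fun x => `|g x - beta_mean beta a b g|).
Proof.
move=> intf absg intfg fmM.
have intg := beta_integrable_norm _ absg.
have [ih <-] := beta_mean_covariance _ _ (2^-1 * (m + M)) intf intg intfg.
have idev := beta_integrable_dev _ (beta_mean beta a b g) absg.
rewrite -beta_meanZ//; apply: normr_beta_mean => //.
  exact: beta_integrableZ.
move=> x /fmM /andP[mf fM]; rewrite normrM ler_wpM2r//.
rewrite ler_norml; apply/andP; split; lra.
Qed.

(* Averaging 2 e |g - d| <= e ^ 2 + (g - d) ^ 2, with e the mean of |g - d|,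
   replaces the Cauchy-Schwarz inequality. *)
Lemma beta_mean_dev_sqr g : abs_beta_integrable beta g a b ->
  beta_integrable beta (fun x => g x * g x) a b ->
  beta_mean beta a b (fun x => `|g x - beta_mean beta a b g|) ^+ 2
  <= beta_mean beta a b (fun x => g x * g x)
     - beta_mean beta a b g * beta_mean beta a b g.
Proof.
move=> absg intgg; have intg := beta_integrable_norm _ absg.
set d := beta_mean beta a b g.
have [ih <-] := beta_mean_covariance _ _ d intg intg intgg.
have idev := beta_integrable_dev _ d absg; rewrite -/d in ih *.
set e := beta_mean beta a b (fun x => `|g x - d|).
have := le_beta_mean (fun x => 2 * e * `|g x - d|)
  (fun x => e ^+ 2 + (g x - d) * (g x - d)).
have ie := beta_integrable_cst (e ^+ 2).
rewrite beta_meanD// beta_meanZ// beta_mean_cst -/e => H.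
(* The left side is [e ^+ 2] twice; cancelling one copy leaves the goal. *)
suff : 2 * e * e <= e ^+ 2 + beta_mean beta a b (fun x => (g x - d) * (g x - d)).
  by rewrite mulr2n mulrDl mul1r mulrDl -expr2 lerD2l.
apply: H; [exact: beta_integrableZ|exact: beta_integrableD|move=> x _].
rewrite -expr2 -(real_normK (num_real (g x - d))) -subr_ge0.
have -> : e ^+ 2 + `|g x - d| ^+ 2 - 2 * e * `|g x - d| = (e - `|g x - d|) ^+ 2.
  by ring.
exact: sqr_ge0.
Qed.

End positivity.

(** * The two inequalities in the extended reals *)

Local Open Scope ereal_scope.

Theorem theorem3p8 (R : realType) (I : interval R) (beta : R -> R) (s0 a b : R)
    (f g : R -> R) (m M : R)
    (hbeta : is_beta_map I beta s0) (aI : a \in I) (bI : b \in I)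
    (ltab : (a < b)%R)
    (intf : abs_beta_integrable beta f a b)
    (intg : abs_beta_integrable beta g a b)
    (fmM : forall x, beta_interval beta s0 a b x -> (m <= f x <= M)%R)
    (as0b : (a <= s0 <= b)%R) :
  `|chebyshev_functional beta a b f g|
    <= (2^-1 * (M - m))%:E *
       (((b - a)^-1)%:E *
        beta_int beta a b (fun x =>
          `|(g x)%:E - ((b - a)^-1)%:E *
                       beta_int beta a b (fun t => (g t)%:E)|)) /\
  (2^-1 * (M - m))%:E *
  (((b - a)^-1)%:E *
   beta_int beta a b (fun x =>
     `|(g x)%:E - ((b - a)^-1)%:E *
                  beta_int beta a b (fun t => (g t)%:E)|))
    <= (2^-1 * (M - m))%:E * sqrte (chebyshev_functional beta a b g g).
Proof.
have iF := beta_integrable_norm hbeta aI bI as0b _ intf.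
have iG := beta_integrable_norm hbeta aI bI as0b _ intg.
(* On the beta-interval [f] is bounded by [|m| + |M|], so the product is dominated by a multiple of
   [|g|]. *)
have iFG : beta_integrable beta (fun x => f x * g x)%R a b.
  apply: (le_beta_integrable hbeta aI bI as0b _
    (fun x => (`|m| + `|M|) * `|g x|)%R).
    exact: beta_integrableZ.
  move=> x /fmM /andP[mf fM]; rewrite normrM ler_wpM2r// ler_norml.
  have [m0 M0] : (0 <= `|m| /\ 0 <= `|M|)%R by [].
  have [lem leM] : (- `|m| <= m /\ M <= `|M|)%R by rewrite lerNnormlW// ler_norm.
  by apply/andP; split; lra.
have idev := beta_integrable_dev hbeta aI bI as0b _ (beta_mean beta a b g) intg.
have mM : (0 <= 2^-1 * (M - m))%R.
  rewrite mulr_ge0 ?invr_ge0// subr_ge0.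
  (* [m <= M] follows from the bounds at [s0], a point of the beta-interval. *)
  by have /andP[] := fmM s0 (or_intror erefl); exact: le_trans.
have -> : (fun x => `|(g x)%:E - ((b - a)^-1)%:E *
    beta_int beta a b (fun t => (g t)%:E)|) =
    (fun x => (`|g x - beta_mean beta a b g|%R)%:E).
  by apply/funext => x; rewrite beta_int_mean.
rewrite beta_int_mean// {1}/chebyshev_functional !beta_int_mean//; split.
  by rewrite lee_fin; exact: (beta_mean_gruss hbeta).
have [iGG|dGG] := pselect (beta_integrable beta (fun x => g x * g x)%R a b).
  rewrite /chebyshev_functional !beta_int_mean// lee_fin ler_wpM2l//.
  (* The mean deviation is nonnegative, hence equals the square root of its square. *)
  rewrite -[leLHS]ger0_norm; last first.
    rewrite -(beta_mean_cst hbeta aI bI ltab 0); apply: (le_beta_mean hbeta) => //.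
    exact: (beta_integrable_cst hbeta).
  by rewrite -sqrtr_sqr ler_wsqrtr// (beta_mean_dev_sqr hbeta).
rewrite /chebyshev_functional (beta_int_mean _ _ _ g)//.
rewrite (beta_int_dvg hbeta aI bI as0b _ _ dGG); last first.
  by move=> x; rewrite -expr2 sqr_ge0.
rewrite gt0_muley ?lte_fin ?invr_gt0 ?subr_gt0// addye//=.
(* Now the square root is +oo. If [M = m] both sides vanish by the convention 0 * +oo = 0; otherwise
   the right side is +oo. *)
move: mM; rewrite le_eqVlt => /predU1P[<-|mM]; first by rewrite !mul0e.
by rewrite gt0_muley ?lte_fin// leey.
Qed.
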